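(* Consider a restpoint chain in $\mathcal M_\infty$ beginning at a restpoint $p_-=(1,-\sqrt{2h},u_0,0)$ with $u_0\in(-\frac\pi2,\frac\pi2)$ and ending at a restpoint $p_+=(1,\sqrt{2h},u_1,0)$ with $\cos u_1\ne0$. Then the total variation of $\theta(\tau)=\theta(u(\tau))$ along the chain is exactly $\pi$, and $u_1=u_0\pm\pi$. There is just one binary collision along the chain (i.e. the chain passes through exactly one restpoint with $\cos u=0$), and $\theta_1=-\theta_0$, where $\theta_i=\theta(u_i)$.
   Context: Fix $h>0$. The shape variables $\theta\in[-\frac\pi2,\frac\pi2]$ and $u\in\mathbb R$ of the isosceles three-body problem are related by $\cos\theta(u)=\cos^2u$, $\sin\theta(u)=\sin u\sqrt{1+\cos^2u}$; binary collision shapes are those with $\cos u=0$. The infinity manifold is $\mathcal M_\infty=\{(s,v,u,w): s=1,\ \tfrac12(v^2\cos^2u+w^2)=h\cos^2u\}$, with flow $$s'=0,\quad v'=w^2,\quad u'=\tfrac12\sqrt{1+\cos^2u}\,w,\quad w'=-vw\cos^2u+\tfrac12(v^2-2h)\sqrt{1+\cos^2u}\,\sin u\cos u .$$ Its restpoints are the points $(1,\pm\sqrt{2h},u,0)$, $u\in\mathbb R$, and the points $(1,v,u,0)$ with $\cos u=0$, $v\in\mathbb{R}$. Each restpoint $q=(1,v,u,0)$ with $\cos u=0$, $|v|<\sqrt{2h}$ has one-dimensional stable and unstable manifolds $W^s(q),W^u(q)$ in $\mathcal M_\infty$. A restpoint chain is a finite sequence of (nonconstant) heteroclinic orbits in $\mathcal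 M_\infty$ obtained by starting at a restpoint $(1,-\sqrt{2h},u_0,0)$, $\cos u_0\neq0$, following one of the two branches of its one-dimensional unstable manifold in $\mathcal M_\infty$ to its limiting restpoint $q$; if $q$ has $\cos u=0$ and $|v|<\sqrt{2h}$, continuing along the branch of $W^u(q)$ on the other side of $q$ in $u$ (i.e. the branch on which $w$ has the same sign, so that $u$ continues monotonically), and so on, until a restpoint $(1,\sqrt{2h},u_1,0)$ is reached. The total variation of $\theta$ along the chain is the sum of the total variations along its orbits. *)

(* Defs.v *)
From HB Require Import structures.
From mathcomp Require Import all_boot all_order all_algebra.
From mathcomp Require Import all_classical all_reals all_analysis.
From mathcomp Require Import ring.

Set Implicit Arguments.
Unset Strict Implicit.
Unset Printing Implicit Defensive.

Import Order.TTheory GRing.Theory Num.Theory.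
Import numFieldNormedType.Exports.

Local Open Scope classical_set_scope.
Local Open Scope ring_scope.

Section IsoscelesInfinity.
Context {R : realType}.

(* A state is (s, v, u, w), with the product topology and norm of R^4. *)
Definition state : Type := (R * R * R * R)%type.

Definition s_of (x : state) : R := x.1.1.1.
Definition v_of (x : state) : R := x.1.1.2.
Definition u_of (x : state) : R := x.1.2.
Definition w_of (x : state) : R := x.2.

(* The shape angle in [-pi/2, pi/2] determined by sin theta = sin u sqrt(1 + cos^2 u)
   and cos theta = cos^2 u; see [shape_angleP]. *)
Definition shape_angle (u : R) : R := asin (sin u * Num.sqrt (1 + cos u ^+ 2)).

Lemma shape_angleP (u : R) :
  [/\ - (pi / 2) <= shape_angle u <= pi / 2,
      cos (shape_angle u) = cos u ^+ 2 &
      sin (shape_angle u) = sin u * Num.sqrt (1 + cos u ^+ 2)].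
Proof.
set x := sin u * Num.sqrt (1 + cos u ^+ 2).
have x2 : 1 - x ^+ 2 = (cos u ^+ 2) ^+ 2.
  by rewrite /x exprMn sqr_sqrtr ?addr_ge0 ?sqr_ge0// sin2cos2; ring.
have x1 : -1 <= x <= 1.
  by rewrite -ler_norml -(@expr_le1 _ 2)// real_normK ?num_real// -subr_ge0 x2 sqr_ge0.
split; last by rewrite asinK// in_itv.
  by rewrite asin_geNpi2//= asin_lepi2.
by rewrite /shape_angle cos_asin// x2 sqrtr_sqr ger0_norm// sqr_ge0.
Qed.

Definition M_infty (h : R) : set state :=
  [set x | s_of x = 1 /\
    2^-1 * (v_of x ^+ 2 * cos (u_of x) ^+ 2 + w_of x ^+ 2)
      = h * cos (u_of x) ^+ 2].

Definition flow_field (h : R) (x : state) : state :=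
  let: (_, v, u, w) := x in
  (0,
   w ^+ 2,
   2^-1 * Num.sqrt (1 + cos u ^+ 2) * w,
   - (v * w * cos u ^+ 2)
     + 2^-1 * (v ^+ 2 - 2 * h) * Num.sqrt (1 + cos u ^+ 2) * sin u * cos u).

Definition restpoint (h : R) (q : state) : Prop :=
  M_infty h q /\ flow_field h q = 0.

Definition orbit_in_M_infty (h : R) (g : R -> state) : Prop :=
  (forall t, M_infty h (g t)) /\
  (forall t, is_derive t (1 : R) g (flow_field h (g t))).

(* The unstable manifold of q in M_infty is the set of points of M_infty whose
   backward orbit tends to q; since it is one-dimensional, each of its branches
   is a single nonconstant orbit. *)
Definition unstable_branch (h : R) (q : state) (g : R -> state) : Prop :=
  [/\ orbit_in_M_infty h g,
      exists t t', g t <> g t' &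
      g @ -oo --> q].

Definition heteroclinic (h : R) (q q' : state) (g : R -> state) : Prop :=
  [/\ restpoint h q, restpoint h q', unstable_branch h q g & g @ +oo --> q'].

Definition binary_collision (q : state) : Prop := cos (u_of q) = 0.

Definition same_w_sign (g g' : R -> state) : Prop :=
  forall t t', Num.sg (w_of (g t)) = Num.sg (w_of (g' t')).

(* The chain consists of the n orbits g 0, ..., g n.-1, where g i joins q i to
   q i.+1; the values q i for i > n and g i for i >= n are irrelevant. *)
Definition restpoint_chain (h u0 u1 : R) (n : nat)
    (q : nat -> state) (g : nat -> R -> state) : Prop :=
  [/\ cos u0 != 0 /\ q 0%N = (1, - Num.sqrt (2 * h), u0, 0),
      q n = (1, Num.sqrt (2 * h), u1, 0),
      forall i, (i < n)%N -> heteroclinic h (q i) (q i.+1) (g i),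
      forall i, (0 < i < n)%N ->
        binary_collision (q i) /\ `|v_of (q i)| < Num.sqrt (2 * h) &
      forall i, (i.+1 < n)%N -> same_w_sign (g i) (g i.+1)].

(* [total_variation a b f] is the library's total variation on [a, b]. *)
Definition line_variation (f : R -> R) : \bar R :=
  ereal_sup [set total_variation ab.1 ab.2 f | ab in [set ab : R * R | ab.1 <= ab.2]].

Definition chain_variation (n : nat) (g : nat -> R -> state) : \bar R :=
  (\sum_(i < n) line_variation (fun t => shape_angle (u_of (g i t))))%E.

End IsoscelesInfinity.

Arguments state : clear implicits.

(* Main.v *)
Require Import Defs.
From mathcomp Require Import all_boot all_order all_algebra.
From mathcomp Require Import all_classical all_reals all_analysis.
From mathcomp Require Import ring lra.

Set Implicit Arguments.
Unset Strict Implicit.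
Unset Printing Implicit Defensive.

Import Order.TTheory GRing.Theory Num.Theory.
Import numFieldNormedType.Exports.

Local Open Scope classical_set_scope.
Local Open Scope ring_scope.

(** The idea is to measure the speed coordinate by an angle too. Put
    r = sqrt (2h). On the infinity manifold w^2 = (r^2 - v^2) cos^2 u, so away
    from collision |v| <= r, and phi = asin (v / r) increases from - pi/2 to
    pi/2 as v increases from - r to r. Along a nonconstant orbit neither w nor
    cos u vanishes, and the flow gives
<<
      theta' = w cos u,        phi' = |w cos u|.
>>
    Hence theta and phi, up to a sign that is fixed on each orbit, differ by a
    constant ([orbit_shape_speed]), and the variation of theta along an orbit
    is the increase of phi. Along a chain these increases telescope, and the
    total is pi.

    That w never vanishes on a nonconstant orbit is a uniqueness statement: a
    point with w = 0 is at rest. It follows from Gronwall's inequality,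
    because |(w^2)'| <= 4 r w^2 on the infinity manifold
    ([orbit_w2_derive_bound]).

    The shape of the chain comes from the same balance. After replacing u by
    - u if w < 0, the coordinate u increases along the whole chain, and each
    orbit stays between two consecutive zeros of the cosine, with theta
    increasing where cos u > 0 and decreasing where cos u < 0. On the first
    orbit u stays below pi/2. Ending at v = r there would need an increase of
    theta by pi from theta_0 > - pi/2, which is too much, so the orbit ends at
    u = pi/2 with phi = - theta_0. On the second orbit u lies in
    ]pi/2, 3pi/2[. A collision at its end would make theta decrease by pi, and
    phi exceed pi/2. So the chain ends there, after theta has decreased from
    pi/2 to - theta_0, and as theta is injective between two collisions and
    changes sign when u increases by pi, this forces u_1 = u_0 + pi
    ([restpoint_chain_shape]). *)

(** * Calculus on the real line *)

Section RealLine.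
Context {R : realType}.
Implicit Types (f df : R -> R).

Lemma is_derive_continuous f df : (forall t, is_derive t (1 : R) f (df t)) ->
  continuous f.
Proof.
by move=> fD t; apply/differentiable_continuous/derivable1_diffP; case: (fD t).
Qed.

Lemma is_derive_ge0_homo f df : (forall t, is_derive t (1 : R) f (df t)) ->
  (forall t, 0 <= df t) -> {homo f : x y / x <= y}.
Proof.
move=> fD df_ge0 x y xy; rewrite -subr_ge0.
have [|c _ ->] := @MVT_segment R f df x y xy (fun t _ => fD t).
  exact/continuous_subspaceT/(is_derive_continuous fD).
by rewrite mulr_ge0 ?subr_ge0.
Qed.

Lemma is_derive_gt0_homo f df : (forall t, is_derive t (1 : R) f (df t)) ->
  (forall t, 0 < df t) -> {homo f : x y / x < y}.
Proof.
move=> fD df_gt0 x y xy; rewrite -subr_gt0.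
have [|c _ ->] := @MVT R f df x y xy (fun t _ => fD t).
  exact/continuous_subspaceT/(is_derive_continuous fD).
by rewrite mulr_gt0 ?subr_gt0.
Qed.

(** The bound says that f exp (K t) is nondecreasing and f exp (- K t) is
    nonincreasing, so a zero of the nonnegative function f propagates backward
    by the first and forward by the second. *)
Lemma gronwall_eq0 f df (K : R) : (forall t, is_derive t (1 : R) f (df t)) ->
  (forall t, 0 <= f t) -> (forall t, `|df t| <= K * f t) ->
  forall t0, f t0 = 0 -> forall t, f t = 0.
Proof.
move=> fD f_ge0 dfK t0 f0 t; apply/eqP; rewrite eq_le f_ge0 andbT.
have expD (k s : R) : is_derive s (1 : R) (fun x => f x * expR (k * x))
    ((df s + k * f s) * expR (k * s)).
  have := fD s => fDs.
  apply: is_derive_eq; rewrite /GRing.scale /=; ring.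
have dfK2 s : - (K * f s) <= df s <= K * f s by rewrite -ler_norml.
(* Before t0 the integrating factor is exp (K s), after t0 it is exp (- K s). *)
have [tt0|t0t] := leP t t0.
- have := @is_derive_ge0_homo _ _ (expD K) _ t t0 tt0.
  rewrite f0 mul0r pmulr_lle0 ?expR_gt0//; apply=> s.
  by rewrite mulr_ge0 ?expR_ge0//; have := dfK2 s; lra.
- have D s : is_derive s (1 : R) (fun x => - (f x * expR (- K * x)))
      (- ((df s + - K * f s) * expR (- K * s))).
    by have := expD (- K) s => h; apply: is_derive_eq.
  have := @is_derive_ge0_homo _ _ D _ t0 t (ltW t0t).
  rewrite f0 mul0r oppr0 oppr_ge0 pmulr_lle0 ?expR_gt0//; apply=> s.
  by rewrite -mulNr mulr_ge0 ?expR_ge0//; have := dfK2 s; lra.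
Qed.

Lemma neq0_sg_const f : continuous f -> (forall t, f t != 0) ->
  forall t t', Num.sg (f t) = Num.sg (f t').
Proof.
move=> fC f0.
suff H t t' : t <= t' -> Num.sg (f t) = Num.sg (f t').
  by move=> t t'; have [/H|/ltW/H] := leP t t'.
move=> tt'; apply/eqP/negPn/negP => sgN.
have [|c _ fc] := @IVT R f t t' 0 tt' (continuous_subspaceT fC).
  rewrite ge_min le_max; move: sgN (f0 t) (f0 t').
  case: (ltgtP (f t) 0) => // ft; case: (ltgtP (f t') 0) => // ft';
    by rewrite ?(gtr0_sg ft) ?(gtr0_sg ft') ?(ltr0_sg ft) ?(ltr0_sg ft') ?eqxx.
by move/eqP: fc; exact/negP.
Qed.

Section Limits.
Context {f : R -> R} {l l' : R}.
Hypotheses (fl : f @ -oo --> l) (fl' : f @ +oo --> l').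

Lemma homo_ge_ninfty : {homo f : x y / x <= y} -> forall t, l <= f t.
Proof.
move=> fnd t; rewrite leNgt; apply/negP => ftl.
near (ninfty_nbhs R) => x.
have : f x <= f t by apply: fnd; near: x; exact: (nbhs_ninfty_le (num_real _)).
rewrite leNgt => /negP; apply; near: x; exact: (cvgr_gt _ fl).
Unshelve. all: by end_near. Qed.

Lemma homo_le_pinfty : {homo f : x y / x <= y} -> forall t, f t <= l'.
Proof.
move=> fnd t; rewrite leNgt; apply/negP => ftl.
near (pinfty_nbhs R) => x.
have : f t <= f x by apply: fnd; near: x; exact: (nbhs_pinfty_ge (num_real _)).
rewrite leNgt => /negP; apply; near: x; exact: (cvgr_lt _ fl').
Unshelve. all: by end_near. Qed.

(** The variation on [a, b] is f b - f a, which tends to the full increase as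
    the segment exhausts the line. *)
Lemma homo_line_variation : {homo f : x y / x <= y} ->
  line_variation f = (l' - l)%:E.
Proof.
move=> fnd.
have tvE a b : a <= b -> total_variation a b f = (f b - f a)%:E.
  by move=> ab; apply: nondecreasing_total_variation => // x y _ _; exact: fnd.
apply/eqP; rewrite eq_le; apply/andP; split.
  apply: ge_ereal_sup => _ [[a b] /= ab <-]; rewrite tvE// lee_fin lerB//.
    exact: homo_le_pinfty.
  exact: homo_ge_ninfty.
apply/lee_addgt0Pr => e e0.
near (ninfty_nbhs R) => a; near (pinfty_nbhs R) => b.
have ab : a <= b.
  by apply: (@le_trans _ _ 0); [near: a; exact: (nbhs_ninfty_le (num_real _))
    |near: b; exact: (nbhs_pinfty_ge (num_real _))].
apply: (@le_trans _ _ ((f b - f a) + e)%:E); last first.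
  rewrite EFinD leeD2r// -tvE//; apply: ereal_sup_ubound.
  by exists (a, b).
have fa : f a < l + e / 2 by near: a; apply: (cvgr_lt _ fl); lra.
have fb : l' - e / 2 < f b by near: b; apply: (cvgr_gt _ fl'); lra.
by rewrite lee_fin; lra.
Unshelve. all: by end_near. Qed.

Lemma homo_lt_ninfty : {homo f : x y / x < y} -> forall t, l < f t.
Proof.
move=> fi t; apply: (@le_lt_trans _ _ (f (t - 1))); last by apply: fi; lra.
exact/homo_ge_ninfty/ltW_homo.
Qed.

Lemma homo_gt_pinfty : {homo f : x y / x < y} -> forall t, f t < l'.
Proof.
move=> fi t; apply: (@lt_le_trans _ _ (f (t + 1))); first by apply: fi; lra.
exact/homo_le_pinfty/ltW_homo.
Qed.

Lemma homo_IVT : continuous f -> {homo f : x y / x < y} ->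
  forall z, l < z < l' -> exists t, f t = z.
Proof.
move=> fC fi z /andP[lz zl'].
near (ninfty_nbhs R) => a; near (pinfty_nbhs R) => b.
have ab : a <= b.
  by apply: (@le_trans _ _ 0); [near: a; exact: (nbhs_ninfty_le (num_real _))
    |near: b; exact: (nbhs_pinfty_ge (num_real _))].
have fa : f a <= z by near: a; apply: (cvgr_le _ fl).
have fb : z <= f b by near: b; apply: (cvgr_ge _ fl').
have [|c _ fc] := @IVT R f a b z ab (continuous_subspaceT fC).
  by rewrite ge_min fa le_max fb orbT.
by exists c.
Unshelve. all: by end_near. Qed.

End Limits.

Lemma line_variationN f : line_variation (\- f) = line_variation f.
Proof.
by congr ereal_sup; apply: eq_imagel => -[a b] _ /=; exact: total_variationN.
Qed.

End RealLine.

(** * The shape angle *)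

Section ShapeAngle.
Context {R : realType}.
Implicit Types (u x y z d : R).

(** Collision shapes are sent to the endpoints of [-1, 1], where asin is not
    differentiable, so continuity is needed up to the boundary. *)
Lemma asin_within_continuous : {within `[-1, 1], continuous (@asin R)}.
Proof.
have pi0 := @pi_gt0 R.
have := @segment_can_le_continuous R (- (pi / 2)) (pi / 2) sin asin _ _ (@sinK R).
rewrite sinN sin_pihalf; apply; first lra.
exact/continuous_subspaceT/continuous_sin.
Qed.

Lemma cvg_asin (T : Type) (F : set_system T) (FF : Filter F) (f : T -> R) (l : R) :
  (forall t, -1 <= f t <= 1) -> -1 <= l <= 1 ->
  f @ F --> l -> asin (f t) @[t --> F] --> asin l.
Proof.
move=> f1 l1 fl.
have /subspace_continuousP/(_ l) := asin_within_continuous.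
rewrite /= in_itv /= => /(_ l1) asinC.
apply: (cvg_trans _ asinC) => A /= As.
apply: (@filterS _ F FF _ _ _ (fl _ As)) => t /=; apply.
by rewrite in_itv /=.
Qed.

Lemma cos_neq0_asin_arg u : cos u != 0 ->
  -1 < sin u * Num.sqrt (1 + cos u ^+ 2) < 1.
Proof.
move=> cu; have [_ _ <-] := shape_angleP u.
have c2 : cos (shape_angle u) != 0.
  by have [_ -> _] := shape_angleP u; rewrite sqrf_eq0.
have : `|sin (shape_angle u)| != 1 by apply: contra_neq c2 => /sin1cos0.
by rewrite -ltr_norml lt_neqAle sin_max andbT.
Qed.

(** Differentiating sin theta = sin u sqrt (1 + cos^2 u) gives
    cos theta theta' = 2 cos^3 u / sqrt (1 + cos^2 u), and
    cos theta = cos^2 u. *)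
Lemma is_derive_shape_angle u : cos u != 0 ->
  is_derive u (1 : R) shape_angle (2 * cos u / Num.sqrt (1 + cos u ^+ 2)).
Proof.
move=> cu.
have r_gt0 : 0 < 1 + cos u ^+ 2 by have := sqr_ge0 (cos u); lra.
have argD : is_derive u (1 : R) (fun u => sin u * Num.sqrt (1 + cos u ^+ 2))
    (2 * cos u ^+ 3 / Num.sqrt (1 + cos u ^+ 2)).
  have := is_derive1_sqrt r_gt0 => sqrtD.
  have c2D : is_derive u (1 : R) (fun u => 1 + cos u ^+ 2) (- (2 * cos u * sin u)).
    by apply: is_derive_eq; rewrite /GRing.scale /=; ring.
  have rD := @is_derive1_comp R Num.sqrt (fun u => 1 + cos u ^+ 2) u _ _ sqrtD c2D.
  have sD := is_derive_sin u.
  apply: (is_derive_eq (is_deriveM sD rD)).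
  rewrite /GRing.scale /=.
  set r := Num.sqrt _.
  have r2 : r ^+ 2 = 1 + cos u ^+ 2 by rewrite sqr_sqrtr// ltW.
  have r0 : r != 0 by rewrite sqrtr_eq0 -ltNge.
  have s2 := sin2cos2 u.
  apply: (mulfI r0); rewrite [RHS]mulrC divfK//.
  transitivity (r ^+ 2 * cos u - cos u * sin u ^+ 2); first by field.
  by rewrite r2 s2; ring.
have asinD := is_derive1_asin (cos_neq0_asin_arg cu).
apply: (is_derive_eq (@is_derive1_comp R asin _ u _ _ asinD argD)).
have <- : sin (shape_angle u) = sin u * Num.sqrt (1 + cos u ^+ 2).
  by have [] := shape_angleP u.
rewrite -cos2sin2; have [_ -> _] := shape_angleP u.
rewrite sqrtr_sqr ger0_norm ?sqr_ge0//; field.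
by rewrite cu sqrtr_eq0 -ltNge r_gt0.
Qed.

Lemma continuous_shape_angle : continuous (@shape_angle R).
Proof.
have arg1 (t : R) : -1 <= sin t * Num.sqrt (1 + cos t ^+ 2) <= 1.
  by have [_ _ <-] := shape_angleP t; rewrite sin_geN1 sin_le1.
move=> u; rewrite /continuous_at.
apply: (@cvg_asin R (nbhs u) _ _ _ arg1 (arg1 u)).
apply: cvgM; first exact: continuous_sin.
apply: continuous_comp; last exact: sqrt_continuous.
by apply: cvgD; [exact: cvg_cst | apply: cvgM; exact: continuous_cos].
Qed.

Lemma shape_angle_eq u x : - (pi / 2) <= x <= pi / 2 ->
  sin x = sin u * Num.sqrt (1 + cos u ^+ 2) -> shape_angle u = x.
Proof. by rewrite /shape_angle => xP <-; rewrite sinK ?in_itv. Qed.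

Lemma shape_angleN u : shape_angle (- u) = - shape_angle u.
Proof.
have [uP _ su] := shape_angleP u.
apply: shape_angle_eq; first lra.
by rewrite !sinN cosN su mulNr.
Qed.

Lemma shape_angleDpi u : shape_angle (u + pi) = - shape_angle u.
Proof.
have [uP _ su] := shape_angleP u.
apply: shape_angle_eq; first lra.
by rewrite sinN su sinDpi cosDpi sqrrN mulNr.
Qed.

Lemma shape_angle_pihalf : shape_angle (pi / 2 : R) = pi / 2.
Proof.
have pi0 := @pi_gt0 R.
apply: shape_angle_eq; first lra.
by rewrite sin_pihalf cos_pihalf expr0n addr0 sqrtr1 mul1r.
Qed.

Lemma shape_angle_lt_pihalf u : cos u != 0 ->
  - (pi / 2) < shape_angle u < pi / 2.
Proof.
move=> /cos_neq0_asin_arg /andP[u1 u2].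
by rewrite /shape_angle asin_gtNpi2 ?asin_ltpi2 ?(ltW u1) ?(ltW u2) ?u1 ?u2.
Qed.

(** Since cos theta = cos^2 u, the angle theta determines cos u up to sign, and
    then sin theta determines sin u. *)
Lemma shape_angle_inj :
  {in `]- (pi / 2), (pi / 2)[ &, injective (@shape_angle R)}.
Proof.
move=> x y; rewrite !in_itv /= => xP yP xy.
have [_ cx sx] := shape_angleP x; have [_ cy sy] := shape_angleP y.
have r_gt0 : 0 < 1 + cos y ^+ 2 by have := sqr_ge0 (cos y); lra.
apply: sin_inj; rewrite ?in_itv /=; [lra|lra|].
move: sx sy; rewrite xy -cx xy cy => -> /mulIf; apply.
by rewrite sqrtr_eq0 -ltNge.
Qed.

(** The trace of a heteroclinic orbit on the shape coordinate: u runs from x to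
    y without meeting a collision, and d is the accompanying increase of the
    speed angle, which theta gains or loses according to the sign of cos u. *)
Record shape_arc (x y d : R) : Prop := ShapeArc {
  shape_arc_lt : x < y;
  shape_arc_gt0 : 0 < d;
  shape_arc_cos : forall z, x < z < y -> cos z != 0;
  shape_arc_diff : forall z, x < z < y ->
    shape_angle y - shape_angle x = Num.sg (cos z) * d }.

Lemma ascending_arc x y d : - (pi / 2) <= x < pi / 2 -> shape_arc x y d ->
  y <= pi / 2 /\ shape_angle y = shape_angle x + d.
Proof.
move=> /andP[x1 x2] [xy d0 cosN0 xyd].
have yP : y <= pi / 2.
  rewrite leNgt; apply/negP => py.
  by have := cosN0 (pi / 2); rewrite cos_pihalf eqxx x2 py => /(_ isT).
split => //; have := xyd ((x + y) / 2); rewrite gtr0_sg ?mul1r; last first.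
  by apply: cos_gt0_pihalf; lra.
by move=> H; have := H ltac:(lra); lra.
Qed.

(** Shifting u by pi changes the sign of theta and of cos u, which turns the arc
    into an ascending one. *)
Lemma descending_arc x y d : pi / 2 <= x < pi + pi / 2 -> shape_arc x y d ->
  y <= pi + pi / 2 /\ shape_angle y = shape_angle x - d.
Proof.
move=> xP [xy d0 cosN0 xyd].
have [||yP yE] := @ascending_arc (x - pi) (y - pi) d; first lra.
  split => // [|z zP|z zP]; first lra.
    by have := cosN0 (z + pi) ltac:(lra); rewrite cosDpi oppr_eq0.
  have := xyd (z + pi) ltac:(lra); rewrite cosDpi sgrN.
  rewrite -[in shape_angle y](subrK pi y) -[in shape_angle x](subrK pi x).
  by rewrite !shape_angleDpi; lra.
rewrite -[in shape_angle y](subrK pi y) -[in shape_angle x](subrK pi x).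
by rewrite !shape_angleDpi; lra.
Qed.

Lemma ascending_arc_collision x y d : - (pi / 2) <= x < pi / 2 -> shape_arc x y d ->
  cos y = 0 -> y = pi / 2.
Proof.
move=> xP xyd cy; have [yP _] := ascending_arc xP xyd.
apply/eqP; rewrite eq_le yP leNgt; apply/negP => ypi.
have := shape_arc_lt xyd => xy.
by have := @cos_gt0_pihalf R y; rewrite cy ltxx => /(_ ltac:(lra)).
Qed.

Lemma descending_arc_collision x y d : pi / 2 <= x < pi + pi / 2 -> shape_arc x y d ->
  cos y = 0 -> y = pi + pi / 2.
Proof.
move=> xP xyd cy; have [yP _] := descending_arc xP xyd.
apply/eqP; rewrite eq_le yP leNgt; apply/negP => ypi.
have := shape_arc_lt xyd => xy.
have := @cos_gt0_pihalf R (y - pi) ltac:(lra).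
by have := cosDpi (y - pi); rewrite subrK cy; lra.
Qed.

End ShapeAngle.

(** * The angle of the speed coordinate *)

Section Projections.
Context {R : realType} {V W : normedModType R}.
Implicit Types (g : R -> V * W) (d : V * W).

Lemma is_derive_fst g d (t : R) : is_derive t (1 : R) g d ->
  is_derive t (1 : R) (fst \o g) d.1.
Proof.
move=> [gD gd].
have H : (fun k => k^-1 *: ((g \o shift t) (k *: (1 : R)) - g t)) @ 0^' --> d.
  by rewrite -gd; exact: gD.
have H1 : (fun k => k^-1 *: (((fst \o g) \o shift t) (k *: (1 : R)) - (fst \o g) t))
    @ 0^' --> d.1.
  exact: (cvg_comp _ _ H (@cvg_fst _ _ _ _ _)).
by split; [apply: cvgP H1 | exact: cvg_lim H1].
Qed.

Lemma is_derive_snd g d (t : R) : is_derive t (1 : R) g d ->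
  is_derive t (1 : R) (snd \o g) d.2.
Proof.
move=> [gD gd].
have H : (fun k => k^-1 *: ((g \o shift t) (k *: (1 : R)) - g t)) @ 0^' --> d.
  by rewrite -gd; exact: gD.
have H1 : (fun k => k^-1 *: (((snd \o g) \o shift t) (k *: (1 : R)) - (snd \o g) t))
    @ 0^' --> d.2.
  exact: (cvg_comp _ _ H (@cvg_snd _ _ _ _ _)).
by split; [apply: cvgP H1 | exact: cvg_lim H1].
Qed.

End Projections.

(** The angle phi such that v = sqrt (2h) sin phi; the energy relation then
    reads w = +- sqrt (2h) cos phi cos u. *)
Definition speed_angle {R : realType} (h v : R) : R := asin (v / Num.sqrt (2 * h)).

Section SpeedAngle.
Context {R : realType} (h : R).
Hypothesis h_gt0 : 0 < h.
Let r : R := Num.sqrt (2 * h).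

Lemma sqrt2h_gt0 : 0 < r.
Proof. by rewrite sqrtr_gt0 mulr_gt0. Qed.

Lemma sqr_sqrt2h : r ^+ 2 = 2 * h.
Proof. by rewrite sqr_sqrtr// mulr_ge0// ltW. Qed.

Lemma speed_ratio_itv v : `|v| <= r -> -1 <= v / r <= 1.
Proof.
have r0 := sqrt2h_gt0.
by rewrite -ler_norml normrM normfV (gtr0_norm r0) ler_pdivrMr ?mul1r.
Qed.

Lemma is_derive_speed_angle v : `|v| < r ->
  is_derive v (1 : R) (speed_angle h) (Num.sqrt (2 * h - v ^+ 2))^-1.
Proof.
have r0 := sqrt2h_gt0 => vr.
have v1 : -1 < v / r < 1.
  by rewrite -ltr_norml normrM normfV (gtr0_norm r0) ltr_pdivrMr ?mul1r.
have lD : is_derive v (1 : R) (fun v => v / r) r^-1.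
  apply: (is_derive_eq (is_deriveM (is_derive_id v 1) (is_derive_cst r^-1 v 1))).
  by rewrite /GRing.scale /= mulr0 add0r mulr1.
apply: (is_derive_eq (@is_derive1_comp R asin _ v _ _ (is_derive1_asin v1) lD)).
rewrite -invfM -[X in _ * X]gtr0_norm// -sqrtr_sqr -sqrtrM; last first.
  by rewrite subr_ge0 -real_normK ?num_real// expr_le1// ler_norml; lra.
congr (Num.sqrt _)^-1; rewrite -sqr_sqrt2h -/r; field.
by rewrite gt_eqF.
Qed.

Lemma cvg_speed_angle (T : Type) (F : set_system T) (FF : ProperFilter F)
    (f : T -> R) (l : R) : (forall t, `|f t| <= r) ->
  f @ F --> l -> speed_angle h (f t) @[t --> F] --> speed_angle h l.
Proof.
move=> fr fl.
have lr : `|l| <= r.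
  rewrite leNgt; apply/negP => rl.
  near F => t; have := fr t; rewrite leNgt => /negP; apply.
  near: t; exact: (cvgr_gt _ (cvg_norm fl)).
apply: (@cvg_asin _ _ _ _ (fun t => f t / r)) => [t||]; try exact: speed_ratio_itv.
by apply: cvgM => //; exact: cvg_cst.
Unshelve. all: by end_near. Qed.

Lemma speed_angle_itv v : `|v| <= r ->
  - (pi / 2) <= speed_angle h v <= pi / 2.
Proof.
by move=> /speed_ratio_itv vP; rewrite /speed_angle asin_geNpi2 ?asin_lepi2.
Qed.

Lemma speed_angle_max : speed_angle h r = pi / 2.
Proof.
have r0 := sqrt2h_gt0; have pi0 := @pi_gt0 R.
have e : r / r = sin (pi / 2) by rewrite sin_pihalf divff ?gt_eqF.
by rewrite /speed_angle e sinK// in_itv /=; lra.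
Qed.

Lemma speed_angle_min : speed_angle h (- r) = - (pi / 2).
Proof.
have r0 := sqrt2h_gt0; have pi0 := @pi_gt0 R.
have e : - r / r = sin (- (pi / 2)).
  by rewrite sinN sin_pihalf mulNr divff ?gt_eqF.
by rewrite /speed_angle e sinK// in_itv /=; lra.
Qed.

End SpeedAngle.

(** * Orbits in the infinity manifold *)

Section Orbits.
Context {R : realType} (h : R) (g : R -> state R).
Hypotheses (h_gt0 : 0 < h) (g_orbit : orbit_in_M_infty h g).
Let v t := v_of (g t).
Let u t := u_of (g t).
Let w t := w_of (g t).
Let r : R := Num.sqrt (2 * h).
Let dw t := - (v t * w t * cos (u t) ^+ 2)
  + 2^-1 * (v t ^+ 2 - 2 * h) * Num.sqrt (1 + cos (u t) ^+ 2)
    * sin (u t) * cos (u t).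

Lemma orbit_derive t :
  [/\ is_derive t (1 : R) (fun t => s_of (g t)) 0,
      is_derive t (1 : R) v (w t ^+ 2),
      is_derive t (1 : R) u (2^-1 * Num.sqrt (1 + cos (u t) ^+ 2) * w t) &
      is_derive t (1 : R) w (dw t)].
Proof.
have gD := g_orbit.2 t.
have g1D := is_derive_fst gD; have g2D := is_derive_fst g1D.
have sD := is_derive_fst g2D; have vD := is_derive_snd g2D.
have uD := is_derive_snd g1D; have wD := is_derive_snd gD.
rewrite /dw /v /u /w /v_of /u_of /w_of /s_of.
move: sD vD uD wD; rewrite /flow_field /=.
by case: (g t) => [[[s0 v0] u0] w0].
Qed.

Lemma orbit_energy t : w t ^+ 2 = (2 * h - v t ^+ 2) * cos (u t) ^+ 2.
Proof. by have [_] := g_orbit.1 t; rewrite -/(v t) -/(u t) -/(w t) => E; lra. Qed.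

Lemma orbit_speed_le t : cos (u t) != 0 -> v t ^+ 2 <= r ^+ 2.
Proof.
move=> cu; rewrite sqr_sqrt2h// -subr_ge0.
have c2 : 0 < cos (u t) ^+ 2 by rewrite exprn_even_gt0.
by rewrite -(pmulr_lge0 _ c2) -orbit_energy sqr_ge0.
Qed.

(** Both terms of (w^2)' contain a factor w. In the second one, the energy
    relation provides another factor w:
    |(v^2 - 2h) cos u| <= r sqrt (r^2 - v^2) |cos u| = r |w|. *)
Lemma orbit_w2_derive_bound t :
  `|2 * w t * dw t| <= 4 * r * w t ^+ 2.
Proof.
have r0 := sqrt2h_gt0 h_gt0; have E := orbit_energy t.
have [cu|cu] := eqVneq (cos (u t)) 0.
  have -> : w t = 0 by apply/eqP; rewrite -sqrf_eq0 E cu expr0n mulr0.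
  by rewrite mulr0 mul0r normr0 expr0n mulr0.
rewrite /dw; set q := Num.sqrt _; set c := cos _; set s := sin _.
have q0 : 0 <= q by exact: sqrtr_ge0.
have s1 : `|s| <= 1 := sin_max (u t).
have c1 : `|c| <= 1 := cos_max (u t).
have c2 : c ^+ 2 <= 1 by rewrite -real_normK ?num_real// expr_le1.
have q2 : q <= 2.
  rewrite -(@ler_pXn2r _ 2) ?nnegrE// sqr_sqrtr; last by rewrite addr_ge0 ?sqr_ge0.
  by rewrite -/c; lra.
have vr : `|v t| <= r.
  rewrite -(@ler_pXn2r _ 2) ?nnegrE// ?(ltW r0)//.
  by rewrite real_normK ?num_real//; exact: orbit_speed_le.
have vc : `|(v t ^+ 2 - 2 * h) * c| <= r * `|w t|.
  rewrite -(@ler_pXn2r _ 2) ?nnegrE ?mulr_ge0// ?(ltW r0)//.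
  rewrite exprMn !real_normK ?num_real// E -/c exprMn [leRHS]mulrA.
  rewrite ler_wpM2r ?sqr_ge0// -opprB sqrrN.
  have := orbit_speed_le cu; rewrite sqr_sqrt2h// => vh.
  by rewrite [leLHS]expr2 ler_wpM2r ?subr_ge0// gerBl sqr_ge0.
rewrite (_ : _ * _ = - (2 * v t * c ^+ 2) * w t ^+ 2
  + ((v t ^+ 2 - 2 * h) * c) * (q * s) * w t); last by field.
apply: (le_trans (ler_normD _ _)).
rewrite [leRHS](_ : _ = 2 * r * 1 * w t ^+ 2 + r * `|w t| * (2 * 1) * `|w t|);
  last by rewrite -[w t ^+ 2]real_normK ?num_real//; ring.
apply: lerD.
  rewrite normrM normrN (normrM _ (c ^+ 2)) (normrM 2) normr_nat.
  rewrite (ger0_norm (sqr_ge0 c)) (ger0_norm (sqr_ge0 (w t))).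
  rewrite ler_wpM2r ?sqr_ge0// ler_pM ?sqr_ge0//.
  by rewrite ler_wpM2l.
rewrite normrM (normrM _ (q * s)) (normrM q) (ger0_norm q0).
by rewrite ler_wpM2r// ler_pM ?mulr_ge0// ler_pM.
Qed.

(** An orbit through a point with w = 0 keeps w = 0, by the Gronwall lemma
    applied to w^2; then v and u have zero derivative. *)
Lemma orbit_w_eq0 t0 : w t0 = 0 -> forall t t', g t = g t'.
Proof.
move=> w0.
have w2D t : is_derive t (1 : R) (fun t => w t ^+ 2) (2 * w t * dw t).
  have [_ _ _ wD] := orbit_derive t.
  apply: (is_derive_eq (is_deriveM wD wD)).
  by rewrite /GRing.scale /=; ring.
have w_eq0 t : w t = 0.
  apply/eqP; rewrite -sqrf_eq0; apply/eqP.
  apply: (gronwall_eq0 w2D _ orbit_w2_derive_bound (t0 := t0)) => [s|].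
    exact: sqr_ge0.
  by rewrite w0 expr0n.
move=> t t'.
have sE : s_of (g t) = s_of (g t') by rewrite (g_orbit.1 t).1 (g_orbit.1 t').1.
have vE : v t = v t'.
  apply: is_derive_0_is_cst => s; have [_ + _ _] := orbit_derive s.
  by rewrite w_eq0 expr0n.
have uE : u t = u t'.
  apply: is_derive_0_is_cst => s; have [_ _ + _] := orbit_derive s.
  by rewrite w_eq0 mulr0.
have wE : w t = w t' by rewrite !w_eq0.
move: sE vE uE wE; rewrite /v /u /w /s_of /v_of /u_of /w_of.
by case: (g t) (g t') => [[[s1 v1] u1] w1] [[[s2 v2] u2] w2] /= -> -> -> ->.
Qed.

Hypothesis g_nonconst : exists t t', g t <> g t'.

Lemma orbit_w_neq0 t : w t != 0.
Proof.
by apply/eqP => w0; have [t1 [t2]] := g_nonconst; apply; exact: (orbit_w_eq0 w0).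
Qed.

Lemma orbit_cos_neq0 t : cos (u t) != 0.
Proof.
apply: contraNneq (orbit_w_neq0 t) => cu.
by rewrite -sqrf_eq0 orbit_energy cu expr0n mulr0.
Qed.

Lemma orbit_speed_lt t : `|v t| < r.
Proof.
have r0 := sqrt2h_gt0 h_gt0.
rewrite -(@ltr_pXn2r _ 2) ?nnegrE ?(ltW r0)// real_normK ?num_real//.
rewrite sqr_sqrt2h// -subr_gt0.
have c2 : 0 < cos (u t) ^+ 2 by rewrite exprn_even_gt0 ?orbit_cos_neq0.
by rewrite -(pmulr_lgt0 _ c2) -orbit_energy exprn_even_gt0 ?orbit_w_neq0.
Qed.

Lemma orbit_v_incr : {homo v : x y / x < y}.
Proof.
apply: (@is_derive_gt0_homo _ v (fun t => w t ^+ 2)) => t.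
  by have [] := orbit_derive t.
by rewrite exprn_even_gt0 ?orbit_w_neq0.
Qed.

Lemma orbit_w_sg t t' : Num.sg (w t) = Num.sg (w t').
Proof.
apply: neq0_sg_const orbit_w_neq0 _ _.
by apply: is_derive_continuous => s; have [] := orbit_derive s.
Qed.

Lemma orbit_u_continuous : continuous u.
Proof. by apply: is_derive_continuous => s; have [] := orbit_derive s. Qed.

Lemma orbit_cos_sg t t' : Num.sg (cos (u t)) = Num.sg (cos (u t')).
Proof.
apply: (@neq0_sg_const _ (fun t => cos (u t))) orbit_cos_neq0 _ _ => s.
apply: continuous_comp; first exact: orbit_u_continuous.
exact: continuous_cos.
Qed.

(** The sign of w allows orbits running in either direction of u to be treated
    alike. *)
Lemma orbit_u_incr t0 : {homo (fun t => Num.sg (w t0) * u t) : x y / x < y}.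
Proof.
apply: is_derive_gt0_homo => t.
  by have [_ _ uD _] := orbit_derive t; exact: (is_deriveZ (Num.sg (w t0)) uD).
have r_gt0 : 0 < 1 + cos (u t) ^+ 2 by have := sqr_ge0 (cos (u t)); lra.
rewrite /GRing.scale /= mulrCA (orbit_w_sg t0 t) -normrEsg mulr_gt0//.
  by rewrite mulr_gt0 ?sqrtr_gt0.
by rewrite normr_gt0 orbit_w_neq0.
Qed.

Lemma orbit_shape_derive t :
  is_derive t (1 : R) (fun t => shape_angle (u t)) (w t * cos (u t)).
Proof.
have [_ _ uD _] := orbit_derive t.
have aD := is_derive_shape_angle (orbit_cos_neq0 t).
apply: (is_derive_eq (@is_derive1_comp R shape_angle u t _ _ aD uD)).
have r_gt0 : 0 < 1 + cos (u t) ^+ 2 by have := sqr_ge0 (cos (u t)); lra.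
by field; rewrite sqrtr_eq0 -ltNge.
Qed.

Lemma orbit_speed_angle_derive t :
  is_derive t (1 : R) (fun t => speed_angle h (v t)) `|w t * cos (u t)|.
Proof.
have [_ vD _ _] := orbit_derive t.
have aD := is_derive_speed_angle h_gt0 (orbit_speed_lt t).
apply: (is_derive_eq (@is_derive1_comp R (speed_angle h) v t _ _ aD vD)).
have -> : 2 * h - v t ^+ 2 = (w t / cos (u t)) ^+ 2.
  by rewrite expr_div_n orbit_energy mulfK// sqrf_eq0 orbit_cos_neq0.
rewrite sqrtr_sqr normrM normfV normrM -[w t ^+ 2]real_normK ?num_real//.
by field; rewrite !normr_eq0 orbit_w_neq0 orbit_cos_neq0.
Qed.

(** The derivatives of theta and phi along the orbit are w cos u and
    |w cos u|, so they agree up to the constant sign of w cos u. *)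
Lemma orbit_shape_speed t t' t0 :
  shape_angle (u t) - shape_angle (u t') = Num.sg (w t0 * cos (u t0)) *
    (speed_angle h (v t) - speed_angle h (v t')).
Proof.
set e := Num.sg _.
have D s : is_derive s (1 : R)
    (fun t => shape_angle (u t) - e * speed_angle h (v t)) 0.
  have D1 := is_deriveZ e (orbit_speed_angle_derive s).
  apply: (is_derive_eq (is_deriveB (orbit_shape_derive s) D1)).
  rewrite /e sgrM (orbit_w_sg t0 s) (orbit_cos_sg t0 s) -sgrM /GRing.scale /=.
  by rewrite -numEsg subrr.
have := is_derive_0_is_cst t t' D.
by rewrite mulrBr; lra.
Qed.

End Orbits.

(** * Heteroclinic orbits *)

Section Chains.
Context {R : realType} (h : R).
Hypothesis h_gt0 : 0 < h.
Let phi (q : state R) : R := speed_angle h (v_of q).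

Lemma cvg_uv_of (F : set_system R) (FF : Filter F) (g : R -> state R) q :
  g @ F --> q ->
  u_of (g t) @[t --> F] --> u_of q /\ v_of (g t) @[t --> F] --> v_of q.
Proof.
move=> gq.
have g1 : (g t).1 @[t --> F] --> q.1.
  exact: (cvg_comp _ _ gq (@cvg_fst _ _ _ _ _)).
have g2 : (g t).1.1 @[t --> F] --> q.1.1.
  exact: (cvg_comp _ _ g1 (@cvg_fst _ _ _ _ _)).
split; first exact: (cvg_comp _ _ g1 (@cvg_snd _ _ _ _ _)).
exact: (cvg_comp _ _ g2 (@cvg_snd _ _ _ _ _)).
Qed.

Lemma cvg_eq_lim (T : Type) (F : set_system T) (FF : ProperFilter F)
    (f k : T -> R) (a b : R) :
  f =1 k -> f @ F --> a -> k @ F --> b -> a = b.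
Proof. by move=> /funext <-; apply: cvg_unique; exact: norm_hausdorff. Qed.

Lemma shape_angle_sgM (e x : R) : e != 0 ->
  shape_angle (Num.sg e * x) = Num.sg e * shape_angle x.
Proof.
by case: sgrP => // _ _; rewrite ?mul1r// !mulN1r shape_angleN.
Qed.

(** The relation between theta and phi along the orbit passes to the limits at
    both ends. As e u is a continuous increasing function of time, each value
    between the ends is taken on the orbit, so cos cannot vanish there. *)
Lemma heteroclinic_arc q q' g : heteroclinic h q q' g ->
  let e := Num.sg (w_of (g 0)) in
  [/\ w_of (g 0) != 0,
      shape_arc (e * u_of q) (e * u_of q') (phi q' - phi q) &
      line_variation (fun t => shape_angle (u_of (g t))) =
        (phi q' - phi q)%:E].
Proof.
move=> [_ _ [g_orbit g_nc gq] gq'] e.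
have [uq vq] := cvg_uv_of _ gq; have [uq' vq'] := cvg_uv_of _ gq'.
have w0 := orbit_w_neq0 h_gt0 g_orbit g_nc.
have c0 := orbit_cos_neq0 h_gt0 g_orbit g_nc.
have vle t : `|v_of (g t)| <= Num.sqrt (2 * h).
  exact/ltW/(orbit_speed_lt h_gt0 g_orbit g_nc).
have phiq : speed_angle h (v_of (g t)) @[t --> -oo] --> phi q.
  exact: cvg_speed_angle.
have phiq' : speed_angle h (v_of (g t)) @[t --> +oo] --> phi q'.
  exact: cvg_speed_angle.
have shq : shape_angle (u_of (g t)) @[t --> -oo] --> shape_angle (u_of q).
  exact: (cvg_comp _ _ uq (@continuous_shape_angle R _)).
have shq' : shape_angle (u_of (g t)) @[t --> +oo] --> shape_angle (u_of q').
  exact: (cvg_comp _ _ uq' (@continuous_shape_angle R _)).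
have phiI : {homo (fun t => speed_angle h (v_of (g t))) : x y / x < y}.
  apply: is_derive_gt0_homo => t.
    exact: orbit_speed_angle_derive g_orbit g_nc t.
  by rewrite normr_gt0 mulf_neq0.
have euI := orbit_u_incr h_gt0 g_orbit g_nc 0.
have euq : e * u_of (g t) @[t --> -oo] --> e * u_of q.
  by apply: cvgM => //; exact: cvg_cst.
have euq' : e * u_of (g t) @[t --> +oo] --> e * u_of q'.
  by apply: cvgM => //; exact: cvg_cst.
set s := Num.sg (w_of (g 0) * cos (u_of (g 0))).
have shE := orbit_shape_speed h_gt0 g_orbit g_nc.
have shapeE0 t : shape_angle (u_of (g t)) - shape_angle (u_of q) =
    s * (speed_angle h (v_of (g t)) - phi q).
  apply: (@cvg_eq_lim R (ninfty_nbhs R) _ _ _ _ _ (fun t' => shE t t' 0)).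
    by apply: cvgB shq; exact: cvg_cst.
  apply: cvgM; first exact: cvg_cst.
  by apply: cvgB phiq; exact: cvg_cst.
have shapeE : shape_angle (u_of q') - shape_angle (u_of q) =
    s * (phi q' - phi q).
  apply: (@cvg_eq_lim R (pinfty_nbhs R) _ _ _ _ _ shapeE0).
    by apply: cvgB shq' _; exact: cvg_cst.
  apply: cvgM; first exact: cvg_cst.
  by apply: cvgB phiq' _; exact: cvg_cst.
have cosE z : e * u_of q < z < e * u_of q' ->
    cos z != 0 /\ Num.sg (cos z) = Num.sg (cos (u_of (g 0))).
  move=> zP; have [|t <-] := homo_IVT euq euq' _ euI zP.
    move=> x; apply: cvgM; first exact: cvg_cst.
    exact: (orbit_u_continuous g_orbit).
  rewrite cos_sg//; split=> //.
  exact: (orbit_cos_sg h_gt0 g_orbit g_nc).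
split => //.
- split => [||z /cosE[]//|z /cosE[_ ->]].
  + exact: lt_trans (homo_lt_ninfty euq euI 0) (homo_gt_pinfty euq' euI 0).
  + rewrite subr_gt0.
    exact: lt_trans (homo_lt_ninfty phiq phiI 0) (homo_gt_pinfty phiq' phiI 0).
  rewrite !shape_angle_sgM// -mulrBr shapeE /s sgrM !mulrA.
  by rewrite -expr2 sqr_sg w0 mul1r.
have [s1|s1] : s = 1 \/ s = -1.
  have : w_of (g 0) * cos (u_of (g 0)) != 0 by rewrite mulf_neq0.
  by rewrite /s; case: sgrP => // _ _; [left|right].
- rewrite (homo_line_variation shq shq') ?shapeE ?s1 ?mul1r// => x y xy.
  have := shapeE0 x; have := shapeE0 y; have := ltW_homo phiI xy.
  by rewrite /= s1; lra.
- rewrite -line_variationN (homo_line_variation (cvgN shq) (cvgN shq')).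
    by congr EFin; move: shapeE; rewrite s1; lra.
  move=> x y xy.
  have := shapeE0 x; have := shapeE0 y; have := ltW_homo phiI xy.
  by rewrite !fctE /= s1; lra.
Qed.

End Chains.

(** * Restpoint chains *)

Section RestpointChains.
Context {R : realType} (h : R) (h_gt0 : 0 < h) (u0 u1 : R) (n : nat)
  (q : nat -> state R) (g : nat -> R -> state R).
Hypothesis chain : restpoint_chain h u0 u1 n q g.
Let phi i : R := speed_angle h (v_of (q i)).

Lemma restpoint_chain_speed_angle : phi 0 = - (pi / 2) /\ phi n = pi / 2.
Proof.
have [[_ q0] qn _ _ _] := chain.
by rewrite /phi q0 qn /v_of /= speed_angle_min// speed_angle_max.
Qed.

Lemma restpoint_chain_gt0 : (0 < n)%N.
Proof.
have [p0 pn] := restpoint_chain_speed_angle.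
have pi0 := @pi_gt0 R.
rewrite lt0n; apply/eqP => n0.
by move: pn; rewrite n0 p0; lra.
Qed.

Lemma restpoint_chain_variation : chain_variation n g = pi%:E.
Proof.
have [_ _ gH _ _] := chain.
rewrite /chain_variation.
under eq_bigr => i _.
  have [_ _ ->] := heteroclinic_arc h_gt0 (gH i (ltn_ord i)).
  over.
rewrite sumEFin -(big_mkord xpredT (fun i => phi i.+1 - phi i)) telescope_sumr//.
have [-> ->] := restpoint_chain_speed_angle.
by congr EFin; lra.
Qed.

(** All orbits of a chain have the same sign e of w, so after the reflection
    of u by e the arcs follow each other with u increasing. *)
Lemma restpoint_chain_arc : exists2 e : R, e = 1 \/ e = -1 &
  forall i, (i < n)%N ->
    shape_arc (e * u_of (q i)) (e * u_of (q i.+1)) (phi i.+1 - phi i).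
Proof.
have [_ _ gH _ sgH] := chain.
have [w0 _ _] := heteroclinic_arc h_gt0 (gH 0 restpoint_chain_gt0).
exists (Num.sg (w_of (g 0 0))).
  by move: w0; case: sgrP => // _ _; [left|right].
have sgE i : (i < n)%N -> Num.sg (w_of (g i 0)) = Num.sg (w_of (g 0%N 0)).
  elim: i => // i IH ilt.
  by rewrite -(sgH i ilt 0 0) IH// ltnW.
move=> i ilt; rewrite -(sgE i ilt).
by have [] := heteroclinic_arc h_gt0 (gH i ilt).
Qed.

Hypotheses (u0_itv : - (pi / 2) < u0 < pi / 2) (cos_u1 : cos u1 != 0).

(** A balance between theta, bounded by pi/2 in absolute value, and the speed
    angle, which increases by exactly pi along the whole chain. *)
Lemma restpoint_chain_shape : exists2 e : R, e = 1 \/ e = -1 &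
  [/\ n = 2%N, cos (u_of (q 1)) = 0 & u1 = u0 + e * pi].
Proof.
have [e eP arcP] := restpoint_chain_arc; exists e => //.
have [[cu0 q0] qn _ qB _] := chain.
have n0 := restpoint_chain_gt0; have [phi0 phin] := restpoint_chain_speed_angle.
have pi0 := @pi_gt0 R.
have cosE (x : R) : cos (e * x) = cos x.
  by case: eP => ->; rewrite ?mul1r// mulN1r cosN.
have x0P : - (pi / 2) < e * u0 < pi / 2 by have := u0_itv; case: eP => ->; lra.
have x0W : - (pi / 2) <= e * u0 < pi / 2 by lra.
have c0 : cos (e * u0) != 0 by rewrite cosE.
have th0 := shape_angle_lt_pihalf c0.
have uq0 : u_of (q 0) = u0 by rewrite q0.
have uqn : u_of (q n) = u1 by rewrite qn.
have arc0 := arcP 0%N n0; rewrite uq0 in arc0.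
have [x1P th1] := ascending_arc x0W arc0.
(* A single orbit would make theta increase by pi from above - pi/2. *)
have [n1|n1] := leqP n 1.
  have n1E : n = 1%N by apply/eqP; rewrite eqn_leq n1 n0.
  have [b _ _] := shape_angleP (e * u_of (q 1)).
  by move: th1 phin; rewrite n1E phi0; lra.
have c1 : cos (u_of (q 1)) = 0 by have [] := qB 1 n1.
have x1E : e * u_of (q 1) = pi / 2.
  by apply: (ascending_arc_collision x0W arc0); rewrite cosE.
rewrite x1E shape_angle_pihalf in th1.
have arc1 := arcP 1%N n1; rewrite x1E in arc1.
have x1W : pi / 2 <= (pi / 2 : R) < pi + pi / 2 by lra.
have [x2P th2] := descending_arc x1W arc1.
rewrite shape_angle_pihalf in th2.
(* A collision at the end of the second orbit would bring the speed angle
   above pi/2. *)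
have [n2|n2] := ltnP 2 n.
  have c2 : cos (u_of (q 2)) = 0 by have [] := qB 2 n2.
  have x2E : e * u_of (q 2) = pi + pi / 2.
    by apply: (descending_arc_collision x1W arc1); rewrite cosE.
  have [_ v2] := qB 2 n2; have p2 := speed_angle_itv h_gt0 (ltW v2).
  rewrite -/(phi 2) in p2.
  move: th2; rewrite x2E addrC shape_angleDpi shape_angle_pihalf; lra.
have nE : n = 2%N by apply/eqP; rewrite eqn_leq n1 n2.
split=> //.
have x2lt := shape_arc_lt arc1.
have phi2 : phi 2 = pi / 2 by rewrite -phin nE.
have uq2 : u_of (q 2) = u1 by rewrite -uqn nE.
move: th2 x2P x2lt; rewrite phi2 uq2 => th2 x2P x2lt.
(* The end of the second orbit is not a collision, so both e u1 - pi and e u0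
   lie in the open interval on which theta is injective. *)
have x2E : e * u1 != pi + pi / 2.
  have : cos (e * u1) != 0 by rewrite cosE.
  by apply: contra_neq => ->; rewrite addrC cosDpi cos_pihalf oppr0.
have x2ltW : e * u1 < pi + pi / 2 by rewrite lt_neqAle x2E x2P.
have : shape_angle (e * u1 - pi) = shape_angle (e * u0).
  have := shape_angleDpi (e * u1 - pi); rewrite subrK; lra.
move=> /shape_angle_inj; rewrite !in_itv /= => E.
have := E ltac:(lra) x0P.
by case: eP => ->; lra.
Qed.

End RestpointChains.

Theorem proposition13 (R : realType) (h : R) (h_gt0 : 0 < h) (u0 u1 : R)
    (u0_itv : - (pi / 2) < u0 < pi / 2) (cos_u1 : cos u1 != 0)
    (n : nat) (q : nat -> state R) (g : nat -> R -> state R)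
    (chain : restpoint_chain h u0 u1 n q g) :
  [/\ chain_variation n g = pi%:E,
      u1 = u0 + pi \/ u1 = u0 - pi,
      exists! i : nat, (i <= n)%N /\ binary_collision (q i) &
      shape_angle u1 = - shape_angle u0].
Proof.
have [e eP [n2 c1 u1E]] := restpoint_chain_shape h_gt0 chain u0_itv cos_u1.
have [[cu0 q0] qn _ _ _] := chain.
split.
- exact: (restpoint_chain_variation h_gt0 chain).
- by rewrite u1E; case: eP => ->; [left|right]; lra.
- exists 1%N; split; first by rewrite n2.
  move=> [|[|[|i]]] [ilt]; rewrite /binary_collision.
  + by rewrite q0 /u_of /= => /eqP; rewrite (negbTE cu0).
  + by [].
  + by rewrite -n2 qn /u_of /= => /eqP; rewrite (negbTE cos_u1).
  + by move: ilt; rewrite n2.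
- rewrite u1E; case: eP => ->; rewrite ?mul1r ?mulN1r ?shape_angleDpi//.
  by have := shape_angleDpi (u0 - pi); rewrite subrK; lra.
Qed.
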